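(* Let $\mathcal{N}_{A\to B}$ be a quantum channel (CPTP map), let $\varepsilon,\delta\in(0,1)$, and let $A'$ be a register with $A'\equiv A$. Suppose there is a pure state $\psi_{AA'}$ such that $R$ (with $2^R$ a positive integer) satisfies $$R\le \mathrm{D}^{\varepsilon}_{\mathrm{H}}\Big((\mathcal{N}_{A\to B}\otimes\mathrm{id}_{A'})(\psi_{AA'})\,\Big\|\,\mathcal{N}_{A\to B}(\psi_A)\otimes\psi_{A'}\Big)-2\log\frac{1}{\delta}.$$ Then there exists an $(R,2\varepsilon+2\delta)$-entanglement-assisted code for $\mathcal{N}_{A\to B}$.
   Context: All logarithms are base 2. For a state $\rho$ and positive semidefinite $\sigma$ on the same space, the smooth hypothesis-testing (min-)relative entropy is $\mathrm{D}^{\varepsilon}_{\mathrm{H}}(\rho\|\sigma)=\sup\{\log\frac{1}{\mathrm{Tr}(\Pi\sigma)}: 0\le\Pi\le I,\ \mathrm{Tr}(\Pi\rho)\ge 1-\varepsilon^2\}$. Marginals are denoted by dropping registers, e.g. $\psi_A=\mathrm{Tr}_{A'}\psi_{AA'}$. An $(R,\varepsilon)$-entanglement-assisted code for $\mathcal{N}_{A\to B}$ consists of: a pure state $\theta_{E_AE_B}$ shared by Alice (holding $E_A$) and Bob (holding $E_B$); for each message $m\in\{1,\dots,2^R\}$ an encoding quantum operation of Alice mapping $E_A$ to the channel input $A$; and a decoding POVM of Bob on $BE_B$ with outcomes in $\{1,\dots,2^R\}$ (output register $M'$), such that for every $m$, $\Pr(M'\neq m\mid M=m)\le\varepsilon^2$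 when Alice encodes $m$, sends $A$ through $\mathcal{N}$, and Bob measures $BE_B$. *)

(* Defs.v *)
(* Scalars: an arbitrary numClosedFieldType C (e.g. algC);
   quantum registers are finite-dimensional, a register of dimension n carries
   operators 'M[C]_n; a bipartite register XY of dims (m,n) carries 'M[C]_(m*n),
   with the basis index |i>|j> encoded as mxvec_index i j. *)
From HB Require Import structures.
From mathcomp Require Import all_boot all_order all_algebra.
Set Implicit Arguments. Unset Strict Implicit. Unset Printing Implicit Defensive.
Import Order.TTheory GRing.Theory Num.Theory.
Local Open Scope ring_scope.

Section Quantum.
Variable C : numClosedFieldType.

Definition dag (m n : nat) (A : 'M[C]_(m, n)) : 'M[C]_(n, m) := (map_mx Num.conj A)^T.

Definition psd (n : nat) (A : 'M[C]_n) : Prop :=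
  forall v : 'cV[C]_n, 0 <= (dag v *m A *m v) 0 0.

Definition is_state (n : nat) (rho : 'M[C]_n) : Prop := psd rho /\ \tr rho = 1.

Definition is_pure_state (n : nat) (psi : 'M[C]_n) : Prop :=
  exists v : 'cV[C]_n, dag v *m v = 1%:M /\ psi = v *m dag v.

Definition tens (m1 n1 m2 n2 : nat) (A : 'M[C]_(m1, n1)) (B : 'M[C]_(m2, n2))
  : 'M[C]_(m1 * m2, n1 * n2) :=
  \sum_(i1 < m1) \sum_(j1 < n1) \sum_(i2 < m2) \sum_(j2 < n2)
     (A i1 j1 * B i2 j2) *: delta_mx (mxvec_index i1 i2) (mxvec_index j1 j2).

Definition ptr2 (m n : nat) (X : 'M[C]_(m * n)) : 'M[C]_m :=
  \matrix_(i, j) \sum_(k < n) X (mxvec_index i k) (mxvec_index j k).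
Definition ptr1 (m n : nat) (X : 'M[C]_(m * n)) : 'M[C]_n :=
  \matrix_(i, j) \sum_(k < m) X (mxvec_index k i) (mxvec_index k j).

Definition blk (a k : nat) (X : 'M[C]_(a * k)) (j1 j2 : 'I_k) : 'M[C]_a :=
  \matrix_(i1, i2) X (mxvec_index i1 j1) (mxvec_index i2 j2).
Definition tens_id (a b : nat) (Phi : 'M[C]_a -> 'M[C]_b) (k : nat)
  (X : 'M[C]_(a * k)) : 'M[C]_(b * k) :=
  \sum_(j1 < k) \sum_(j2 < k) tens (Phi (blk X j1 j2)) (delta_mx j1 j2 : 'M[C]_k).
Arguments tens_id [a b] Phi k X.

Definition linear_map (a b : nat) (Phi : 'M[C]_a -> 'M[C]_b) : Prop :=
  forall (c : C) (X Y : 'M[C]_a), Phi (c *: X + Y) = c *: Phi X + Phi Y.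

Definition is_CPTP (a b : nat) (Phi : 'M[C]_a -> 'M[C]_b) : Prop :=
  [/\ linear_map Phi,
      (forall (k : nat) (X : 'M[C]_(a * k)), psd X -> psd (tens_id Phi k X))
    & (forall X : 'M[C]_a, \tr (Phi X) = \tr X)].

Definition is_POVM (M n : nat) (Lam : 'I_M -> 'M[C]_n) : Prop :=
  (forall m, psd (Lam m)) /\ \sum_(m < M) Lam m = 1%:M.

(* "t <= 2^(D_H^eps(rho||sigma))", i.e. t <= sup { 1 / Tr(Pi sigma) } over
   0 <= Pi <= I with Tr(Pi rho) >= 1 - eps^2 (1/0 = +infinity).  Written out:
   every x < t is strictly exceeded by some feasible 1/Tr(Pi sigma),
   i.e. x * Tr(Pi sigma) < 1. *)
Definition exp2_DH_ge (n : nat) (rho sigma : 'M[C]_n) (eps t : C) : Prop :=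
  forall x : C, x < t ->
    exists Pi : 'M[C]_n,
      [/\ psd Pi, psd (1%:M - Pi), 1 - eps ^+ 2 <= \tr (Pi *m rho)
        & x * \tr (Pi *m sigma) < 1].

(* an (R, eps)-entanglement-assisted code for N : 'M_a -> 'M_b with
   M = 2^R messages (labelled by 'I_M) *)
Definition EA_code (a b : nat) (N : 'M[C]_a -> 'M[C]_b) (M : nat) (eps : C) : Prop :=
  exists (eA eB : nat) (theta : 'M[C]_(eA * eB))
         (Enc : 'I_M -> 'M[C]_eA -> 'M[C]_a) (Dec : 'I_M -> 'M[C]_(b * eB)),
    [/\ is_pure_state theta,
        (forall m, is_CPTP (Enc m)),
        is_POVM Dec
      & forall m : 'I_M,
          \sum_(m' < M | m' != m)
             \tr (Dec m' *m tens_id (fun X => N (Enc m X)) eB theta)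
          <= eps ^+ 2].

End Quantum.
Arguments tens_id [C a b] Phi k X.

(* Main.v *)
(* Position-based decoding: Alice and Bob share M copies of psi, and to send m Alice
   feeds the A-half of the m-th copy into the channel.  Bob's state, restricted to the
   channel output and the j-th copy of A', is then N(psi) for j = m and
   N(psi_A) (x) psi_A' otherwise, so the hypothesis test applied at position j separates
   the messages.  The tests are combined into a POVM by the pretty good measurement,
   whose error the Hayashi-Nagaoka inequality bounds by twice the error of the right
   test plus four times the acceptance of the wrong ones:
   2 eps^2 + 4 (delta^2 + 2 eps delta) + 2 eps^2 = (2 eps + 2 delta)^2, the last summand
   paying for making the sum of the tests invertible. *)
Require Import Defs.
From HB Require Import structures.
From mathcomp Require Import all_boot all_order all_algebra.
From mathcomp Require Import ring.
Import Order.TTheory GRing.Theory Num.Theory.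
Local Open Scope ring_scope.
Set Implicit Arguments. Unset Strict Implicit. Unset Printing Implicit Defensive.

(** * Positive semidefinite matrices, up to the Hayashi-Nagaoka inequality *)

Section PositiveMatrices.
Variable C : numClosedFieldType.

Lemma dagE m n (A : 'M[C]_(m, n)) i j : dag A i j = (A j i)^*.
Proof. by rewrite !mxE. Qed.

Lemma dagK m n (A : 'M[C]_(m, n)) : dag (dag A) = A.
Proof. by apply/matrixP=> i j; rewrite !dagE conjCK. Qed.

Lemma dagM m n p (A : 'M[C]_(m, n)) (B : 'M[C]_(n, p)) :
  dag (A *m B) = dag B *m dag A.
Proof. by rewrite /dag map_mxM trmx_mul. Qed.

Lemma dagD m n (A B : 'M[C]_(m, n)) : dag (A + B) = dag A + dag B.
Proof. by apply/matrixP=> i j; rewrite !mxE rmorphD. Qed.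

Lemma dagB m n (A B : 'M[C]_(m, n)) : dag (A - B) = dag A - dag B.
Proof. by apply/matrixP=> i j; rewrite !mxE rmorphB. Qed.

Lemma dagZ m n c (A : 'M[C]_(m, n)) : dag (c *: A) = c^* *: dag A.
Proof. by apply/matrixP=> i j; rewrite !mxE rmorphM. Qed.

Lemma dag_scalar n (c : C) : dag (c%:M : 'M_n) = (c^*)%:M.
Proof. by apply/matrixP=> i j; rewrite !mxE rmorphMn eq_sym. Qed.

Lemma dag_diag n (d : 'rV[C]_n) : dag (diag_mx d) = diag_mx (map_mx Num.conj d).
Proof. by rewrite /dag map_diag_mx tr_diag_mx. Qed.

Lemma psd0 n : psd (0 : 'M[C]_n).
Proof. by move=> v; rewrite mulmx0 mul0mx mxE. Qed.

Lemma psdD n (A B : 'M[C]_n) : psd A -> psd B -> psd (A + B).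
Proof. by move=> pA pB v; rewrite mulmxDr mulmxDl mxE addr_ge0. Qed.

Lemma psdZ n c (A : 'M[C]_n) : 0 <= c -> psd A -> psd (c *: A).
Proof. by move=> c0 pA v; rewrite -scalemxAr -scalemxAl mxE mulr_ge0. Qed.

Lemma psd_sum n (I : finType) (P : pred I) (F : I -> 'M[C]_n) :
  (forall i, P i -> psd (F i)) -> psd (\sum_(i | P i) F i).
Proof. by move=> pF; elim/big_ind: _ => //; [exact: psd0 | exact: psdD]. Qed.

Lemma psd_conj m n (A : 'M[C]_n) (B : 'M[C]_(n, m)) :
  psd A -> psd (dag B *m A *m B).
Proof. by move=> pA v; have := pA (B *m v); rewrite dagM !mulmxA. Qed.

Lemma psd_gram m n (B : 'M[C]_(m, n)) : psd (dag B *m B).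
Proof.
move=> v; rewrite mulmxA -dagM -mulmxA mxE sumr_ge0 // => i _.
by rewrite dagE mulrC mul_conjC_ge0.
Qed.

Lemma psd1 n : psd (1%:M : 'M[C]_n).
Proof. by have := psd_gram (1%:M : 'M[C]_n); rewrite mulmx1 dag_scalar conjC1. Qed.

(** Polarization: testing on [e_i + c e_j] with [c = 1] and [c = 'i] gives two independent equations
    in [B i j] and [B j i]. *)
Lemma quad_eq0 n (B : 'M[C]_n) :
  (forall v : 'cV[C]_n, (dag v *m B *m v) 0 0 = 0) -> B = 0.
Proof.
move=> B0; apply/matrixP=> i j; rewrite [RHS]mxE.
have dq k l : dag (delta_mx k 0 : 'cV[C]_n) *m B *m (delta_mx l 0 : 'cV_n) = (B k l)%:M.
  apply/matrixP=> s t; rewrite !ord1 -mulmxA -colE [LHS]mxE (bigD1 k) //= big1 => [|r rk].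
    by rewrite dagE !mxE !eqxx conjC1 mul1r addr0.
  by rewrite dagE !mxE (negbTE rk) conjC0 mul0r.
have pol c : c^* * B j i + c * B i j = 0.
  have := B0 (delta_mx i 0 + c *: delta_mx j 0).
  rewrite dagD dagZ !(mulmxDl, mulmxDr) -!scalemxAl -!scalemxAr !dq.
  have := B0 (delta_mx i 0); rewrite dq !mxE /= => ->.
  have := B0 (delta_mx j 0); rewrite dq !mxE /= => ->.
  by rewrite !mulr1n !mulr0 addr0 add0r addrC.
have e1 := pol 1; have e2 := pol 'i.
rewrite conjC1 !mul1r in e1; rewrite conjCi in e2.
have /eqP : 'i * (B i j *+ 2) = 0.
  have -> : 'i * (B i j *+ 2) = (- 'i * B j i + 'i * B i j) + 'i * (B j i + B i j).
    by ring.
  by rewrite e1 e2 mulr0 addr0.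
by rewrite mulf_eq0 (negbTE (neq0Ci C)) mulrn_eq0 => /eqP.
Qed.

(** A nonnegative scalar is real, so the quadratic form of [A - dag A] vanishes. *)
Lemma psd_herm n (A : 'M[C]_n) : psd A -> dag A = A.
Proof.
move=> pA; apply/eqP; rewrite -subr_eq0; apply/eqP; apply: quad_eq0 => v.
rewrite mulmxBr mulmxBl mxE [X in _ + X]mxE.
have -> : dag v *m dag A *m v = dag (dag v *m A *m v).
  by rewrite !dagM dagK mulmxA.
by rewrite dagE geC0_conj ?subrr.
Qed.

Lemma herm_spectral n (A : 'M[C]_n) : dag A = A ->
  exists (P : 'M[C]_n) (d : 'rV[C]_n),
    [/\ P *m dag P = 1%:M, dag P *m P = 1%:M & A = dag P *m diag_mx d *m P].
Proof.
move=> hA; have : A \is normalmx.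
  by apply/normalmxP; rewrite -map_trmx -/(dag A) hA.
case/orthomx_spectral_subproof => -[/= P d] uP AE.
have PP : P *m dag P = 1%:M by move/unitarymxP: uP; rewrite -map_trmx.
exists P, d; split=> //; first exact: mulmx1C.
by rewrite AE invmx_unitary // -map_trmx.
Qed.

Lemma quad_diag n (d : 'rV[C]_n) (v : 'cV[C]_n) :
  (dag v *m diag_mx d *m v) 0 0 = \sum_i d 0 i * (v i 0 * (v i 0)^*).
Proof.
rewrite mul_mx_diag mxE; apply: eq_bigr => i _; rewrite !mxE; ring.
Qed.

Lemma psd_diag n (d : 'rV[C]_n) : (forall i, 0 <= d 0 i) -> psd (diag_mx d).
Proof.
move=> d0 v; rewrite quad_diag sumr_ge0 // => i _.
by rewrite mulr_ge0 // mul_conjC_ge0.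
Qed.

Lemma psd_diag_ge0 n (d : 'rV[C]_n) i : psd (diag_mx d) -> 0 <= d 0 i.
Proof.
move=> /(_ (delta_mx i 0)); rewrite quad_diag (bigD1 i) //= big1 => [|j ji].
  by rewrite !mxE !eqxx conjC1 !mulr1 addr0.
by rewrite !mxE (negbTE ji) !mul0r mulr0.
Qed.

Lemma psd_spectral n (A : 'M[C]_n) : psd A ->
  exists (P : 'M[C]_n) (d : 'rV[C]_n),
    [/\ P *m dag P = 1%:M, dag P *m P = 1%:M, A = dag P *m diag_mx d *m P
      & forall i, 0 <= d 0 i].
Proof.
move=> pA; have [P [d [PP' P'P AE]]] := herm_spectral (psd_herm pA).
exists P, d; split=> // i; apply: psd_diag_ge0.
have := psd_conj (dag P) pA.
by rewrite AE dagK !mulmxA PP' mul1mx -mulmxA PP' mulmx1.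
Qed.

Lemma diag_mxM n (d e : 'rV[C]_n) :
  diag_mx d *m diag_mx e = diag_mx (\row_i (d 0 i * e 0 i)).
Proof.
rewrite mul_diag_mx; apply/matrixP=> i j; rewrite !mxE.
by case: eqP => [->|]; rewrite ?mulr1n // !mulr0n mulr0.
Qed.

Lemma conj_diagM {n} {P : 'M[C]_n} (d e : 'rV[C]_n) : P *m dag P = 1%:M ->
  (dag P *m diag_mx d *m P) *m (dag P *m diag_mx e *m P)
  = dag P *m diag_mx (\row_i (d 0 i * e 0 i)) *m P.
Proof.
move=> PP'; rewrite -diag_mxM !mulmxA.
by rewrite -(mulmxA _ P (dag P)) PP' mulmx1.
Qed.

Lemma psd_factor n (A : 'M[C]_n) : psd A -> exists G : 'M[C]_n, A = dag G *m G.
Proof.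
move=> /psd_spectral[P [d [PP' _ -> d0]]].
exists (diag_mx (\row_i sqrtC (d 0 i)) *m P).
rewrite dagM dag_diag !mulmxA -[in RHS](mulmxA (dag P)) diag_mxM; congr (_ *m diag_mx _ *m _).
by apply/rowP=> i; rewrite !mxE geC0_conj ?sqrtC_ge0 // -expr2 sqrtCK.
Qed.

Lemma tr_psdM_ge0 n (A B : 'M[C]_n) : psd A -> psd B -> 0 <= \tr (A *m B).
Proof.
move=> pA /psd_factor[G ->]; rewrite mulmxA mxtrace_mulC mulmxA sumr_ge0 // => i _.
have := psd_conj (dag G) pA (delta_mx i 0); rewrite dagK.
rewrite -mulmxA -colE mxE (bigD1 i) //= big1 => [|j ji].
  by rewrite !mxE !eqxx conjC1 mul1r addr0.
by rewrite !mxE (negbTE ji) conjC0 mul0r.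
Qed.

(** The gap [c] keeps the eigenvalues of [S] positive; [Q] and [R] are [S^(1/2)] and [S^(-1/2)],
    built in one eigenbasis. *)
Lemma psd_inv_sqrt n (S : 'M[C]_n) c : 0 < c -> psd (S - c%:M) ->
  exists Q R : 'M[C]_n,
    [/\ psd Q, dag R = R, Q *m Q = S, R *m Q = 1%:M & Q *m R = 1%:M].
Proof.
move=> c0 pS.
have hS : dag S = S.
  have := psd_herm pS; rewrite dagB dag_scalar geC0_conj ?ltW //.
  by move/(congr1 (fun X => X + c%:M)); rewrite !subrK.
have [P [d [PP' P'P SE]]] := herm_spectral hS.
have d0 i : 0 < d 0 i.
  apply: lt_le_trans c0 _; rewrite -subr_ge0.
  have -> : d 0 i - c = (d - const_mx c) 0 i by rewrite !mxE.
  apply: psd_diag_ge0; have := psd_conj (dag P) pS.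
  rewrite SE dagK mulmxBr mulmxBl !mulmxA PP' mul1mx -mulmxA PP' mulmx1.
  by rewrite scalar_mxC -mulmxA PP' mulmx1 linearB /= diag_const_mx.
have s0 i : 0 < sqrtC (d 0 i) by rewrite sqrtC_gt0.
have diag1 : diag_mx (const_mx 1) = 1%:M :> 'M[C]_n by rewrite diag_const_mx.
exists (dag P *m diag_mx (\row_i sqrtC (d 0 i)) *m P).
exists (dag P *m diag_mx (\row_i (sqrtC (d 0 i))^-1) *m P).
have inv1 (f : 'rV[C]_n) : (forall i, f 0 i = 1) -> dag P *m diag_mx f *m P = 1%:M.
  move=> f1; have -> : f = const_mx 1 by apply/rowP=> i; rewrite f1 mxE.
  by rewrite diag1 mulmx1.
split.
- by apply/psd_conj/psd_diag => i; rewrite mxE ltW.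
- rewrite !dagM dagK dag_diag mulmxA; congr (_ *m diag_mx _ *m _).
  by apply/rowP=> i; rewrite !mxE geC0_conj // invr_ge0 ltW.
- rewrite (conj_diagM _ _ PP') SE; congr (_ *m diag_mx _ *m _).
  by apply/rowP=> i; rewrite !mxE -expr2 sqrtCK.
- by rewrite (conj_diagM _ _ PP') inv1 // => i; rewrite !mxE mulVf // gt_eqF.
- by rewrite (conj_diagM _ _ PP') inv1 // => i; rewrite !mxE mulfV // gt_eqF.
Qed.

(** Operator monotonicity of the square root, by excluding a positive eigenvalue of [T - Q]. *)
Lemma sqr_psd_le n (Q T : 'M[C]_n) : psd Q -> dag T = T ->
  psd (Q *m Q - T *m T) -> psd (Q - T).
Proof.
move=> pQ hT pQT; have hQ := psd_herm pQ.
have hD : dag (T - Q) = T - Q by rewrite dagB hT hQ.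
have [P [d [PP' P'P DE]]] := herm_spectral hD.
(* [herm_spectral] does not state that the eigenvalues are real; this is read off the diagonal of
   [P (T - Q) P^dag]. *)
have dR i : d 0 i \is Num.real.
  have := congr1 (fun X => (P *m X *m dag P) i i) hD.
  rewrite DE !dagM dagK dag_diag !mulmxA PP' !mul1mx -!mulmxA PP' !mulmx1.
  by rewrite !mxE eqxx !mulr1n => /eqP; rewrite CrealE.
have -> : Q - T = dag P *m diag_mx (- d) *m P.
  by rewrite -[LHS]opprB DE linearN /= mulmxN mulNmx.
apply/psd_conj/psd_diag => i; rewrite mxE oppr_ge0.
case: (real_leP (dR i) (real0 _)) => // di0.
(* [v] is a unit eigenvector of [T - Q] for a positive eigenvalue [d 0 i], so
   [|Tv|^2 = |Qv|^2 + 2 d <v, Qv> + d^2 > |Qv|^2], a contradiction. *)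
pose v := dag (row i P).
have vv : dag v *m v = 1%:M.
  rewrite dagK; apply/matrixP=> s t; rewrite !ord1.
  have := congr1 (fun X : 'M_n => X i i) PP'; rewrite !mxE eqxx => <-.
  by apply: eq_bigr => j _; rewrite !mxE.
have Tv : T *m v = Q *m v + d 0 i *: v.
  apply/eqP; rewrite addrC -subr_eq -mulmxBl DE; apply/eqP.
  have -> : v = dag P *m delta_mx i 0.
    by rewrite -colE; apply/colP=> j; rewrite !mxE.
  rewrite -!mulmxA (mulmxA P) PP' mul1mx scalemxAr; congr (_ *m _).
  by rewrite mul_diag_mx; apply/colP=> j; rewrite !mxE; case: eqP => [->|]; rewrite ?mulr0.
have := pQT v; rewrite mulmxBr mulmxBl !mulmxA.
have -> : dag v *m Q *m Q *m v = dag (Q *m v) *m (Q *m v) by rewrite dagM hQ !mulmxA.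
have -> : dag v *m T *m T *m v = dag (T *m v) *m (T *m v) by rewrite dagM hT !mulmxA.
rewrite Tv dagD dagZ (CrealP (dR i)) !(mulmxDl, mulmxDr) -!scalemxAl -!scalemxAr vv.
have -> : dag (Q *m v) *m v = dag v *m Q *m v by rewrite dagM hQ.
rewrite !mulmxA; have := pQ v.
move: (dag v *m Q *m v) (dag (Q *m v) *m Q *m v) => q r q0; rewrite !mxE eqxx mulr1n mulr1.
have -> (x y : C) : x - (x + d 0 i * y + (d 0 i * y + d 0 i * d 0 i))
   = - (d 0 i * y + d 0 i * y + d 0 i ^+ 2) by ring.
rewrite oppr_ge0 => le0.
have : 0 < d 0 i * q 0 0 + d 0 i * q 0 0 + d 0 i ^+ 2.
  by rewrite ltr_wpDl ?exprn_gt0 // addr_ge0 // mulr_ge0 // ltW.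
by move/lt_le_trans/(_ le0); rewrite ltxx.
Qed.

(** Splitting [T (1 - T)] into two congruences of positive matrices avoids diagonalizing [T]. *)
Lemma psd_sqr_le n (T : 'M[C]_n) : psd T -> psd (1%:M - T) -> psd (T - T *m T).
Proof.
move=> pT pT1; have hT := psd_herm pT.
have -> : T - T *m T = dag (1%:M - T) *m T *m (1%:M - T) + dag T *m (1%:M - T) *m T.
  rewrite dagB dag_scalar conjC1 hT !(mulmxBl, mulmxBr, mul1mx, mulmx1).
  set T2 := T *m T; set T3 := _ *m T.
  by apply/matrixP=> i j; rewrite !mxE; ring.
by apply: psdD; apply: psd_conj.
Qed.

(** Here [Q = (T + U)^(1/2)] and [R] is its inverse: [R U R] is the error operator of the pretty
    good measurement when [T] is the right test and [U] the sum of the wrong ones. *)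
Lemma hayashi_nagaoka n (T U Q R : 'M[C]_n) :
  psd T -> psd (1%:M - T) -> psd U -> psd Q -> dag R = R ->
  Q *m Q = T + U -> R *m Q = 1%:M -> Q *m R = 1%:M ->
  psd (2 *: (1%:M - T) + 4 *: U - R *m U *m R).
Proof.
move=> pT pT1 pU pQ hR QQ RQ QR.
(* [Q^2 = T + U >= T >= T^2], and the square root is monotone. *)
have pQT : psd (Q - T).
  apply: sqr_psd_le (psd_herm pT) _ => //.
  by rewrite QQ addrAC; apply: psdD pU; apply: psd_sqr_le.
have RS : R *m (T + U) = Q by rewrite -QQ mulmxA RQ mul1mx.
have SR : (T + U) *m R = Q by rewrite -QQ -mulmxA QR mulmx1.
have RSR : R *m (T + U) *m R = 1%:M by rewrite RS.
(* Two completed squares plus [4 (Q - T)]; in the expansion [R T] and [T R] are eliminated through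
   [R (T + U) = Q = (T + U) R]. *)
have -> : 2 *: (1%:M - T) + 4 *: U - R *m U *m R =
    dag (R - 2%:M) *m U *m (R - 2%:M) + 2 *: (dag (R - 1%:M) *m T *m (R - 1%:M))
    + 4 *: (Q - T).
  rewrite !dagB !dag_scalar hR conjC1 conjC_nat.
  rewrite !(mulmxBl, mulmxBr, mul1mx, mulmx1, mul_scalar_mx, mul_mx_scalar).
  rewrite !(mulmxDl, mulmxDr) in RS SR RSR.
  rewrite -!scalemxAl.
  have -> : R *m T = Q - R *m U by rewrite -RS addrK.
  have -> : T *m R = Q - U *m R by rewrite -SR addrK.
  rewrite mulmxBl QR.
  move: (R *m U *m R) (R *m U) (U *m R) (1%:M : 'M[C]_n) => X Y Z I1.
  by apply/matrixP=> i j; rewrite !mxE; ring.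
apply: psdD; [apply: psdD|]; first exact: psd_conj.
  by apply: psdZ => //; apply: psd_conj.
exact: psdZ.
Qed.

End PositiveMatrices.

(** * Decoding by the pretty good measurement *)

Section PrettyGoodMeasurement.
Variable C : numClosedFieldType.

(** The POVM is [R T_m R] with [R] the inverse square root of the sum of all tests, so it sums
    exactly to the identity; the bound is Hayashi-Nagaoka traced against [w]. *)
Lemma pretty_good_measurement n M (T : 'I_M -> 'M[C]_n) c :
  (0 < M)%N -> 0 < c ->
  (forall m, psd (T m - c%:M)) -> (forall m, psd (1%:M - T m)) ->
  exists Lam : 'I_M -> 'M[C]_n, is_POVM Lam /\
    forall (m : 'I_M) w, psd w ->
      \sum_(j < M | j != m) \tr (Lam j *m w)
      <= 2 * \tr ((1%:M - T m) *m w) + 4 * \sum_(j < M | j != m) \tr (T j *m w).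
Proof.
move=> M0 c0 pTc pT1; pose m0 := Ordinal M0.
have pT m : psd (T m).
  rewrite -(subrK c%:M (T m)); apply: psdD (pTc m) _.
  by rewrite -scalemx1; apply: psdZ; [exact: ltW | exact: psd1].
have pSc : psd (\sum_m T m - c%:M).
  rewrite (bigD1 m0) //= addrAC; apply: psdD (pTc _) _.
  exact: psd_sum.
have [Q [R [pQ hR QQ RQ QR]]] := psd_inv_sqrt c0 pSc.
have RSR : R *m (\sum_m T m) *m R = 1%:M.
  by rewrite -QQ mulmxA RQ mul1mx QR.
exists (fun m => R *m T m *m R); split.
  split=> [m|]; first by rewrite -{1}hR; apply: psd_conj.
  by rewrite -mulmx_suml -mulmx_sumr.
move=> m w pw; pose U := \sum_(j < M | j != m) T j.
have pU : psd U by apply: psd_sum.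
have SE : \sum_m T m = T m + U by rewrite (bigD1 m).
rewrite SE in QQ.
have := tr_psdM_ge0 (hayashi_nagaoka (pT m) (pT1 m) pU pQ hR QQ RQ QR) pw.
rewrite [_ *m w]mulmxBl [X in X - _]mulmxDl -!scalemxAl linearB linearD !linearZ /= subr_ge0.
have trU (A B : 'M[C]_n) : \tr (A *m U *m B *m w) =
    \sum_(j < M | j != m) \tr (A *m T j *m B *m w).
  by rewrite mulmx_sumr !mulmx_suml linear_sum.
have -> : \tr (U *m w) = \sum_(j < M | j != m) \tr (T j *m w).
  by rewrite mulmx_suml linear_sum.
by rewrite trU.
Qed.

(** [al] and [be] bound the two kinds of error of the tests, and [c] is the weight of the trivial
    test. Mixing does not raise the bound on the first kind and adds at most [c] to the second. *)
Lemma hypothesis_decoder n M (T w : 'I_M -> 'M[C]_n) (al be c : C) :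
  (0 < M)%N -> 0 < c <= 1 -> 0 <= al -> 0 <= be ->
  (forall m, psd (T m)) -> (forall m, psd (1%:M - T m)) ->
  (forall m, psd (w m)) -> (forall m, \tr (w m) = 1) ->
  (forall m, 1 - al <= \tr (T m *m w m)) ->
  (forall m j, j != m -> \tr (T j *m w m) <= be) ->
  exists Lam : 'I_M -> 'M[C]_n, is_POVM Lam /\
    forall m, \sum_(j < M | j != m) \tr (Lam j *m w m)
              <= 2 * al + 4 * (M%:R * (be + c)).
Proof.
move=> M0 /andP[c0 c1] al0 be0 pT pT1 pw w1 Tm Tj.
(* Mixing each test with the trivial one makes the sum of the tests invertible. *)
pose T' m := (1 - c) *: T m + c%:M.
have c1' : 0 <= 1 - c by rewrite subr_ge0.
have [m|m|Lam [pLam err]] := @pretty_good_measurement n M T' c M0 c0.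
- by rewrite /T' addrK; apply: psdZ.
- have -> : 1%:M - T' m = (1 - c) *: (1%:M - T m).
    by rewrite /T' scalerBr scalemx1 opprD addrA addrAC -raddfB.
  exact: psdZ.
exists Lam; split=> // m; apply: le_trans (err m _ (pw m)) _.
have trT' j : \tr (T' j *m w m) = (1 - c) * \tr (T j *m w m) + c.
  by rewrite /T' mulmxDl -scalemxAl mul_scalar_mx linearD !linearZ /= w1 mulr1.
apply: lerD; apply: ler_wpM2l => //.
  rewrite mulmxBl mul1mx linearB /= trT' w1.
  have -> (t : C) : 1 - ((1 - c) * t + c) = (1 - c) * (1 - t) by ring.
  have t1 : 1 - \tr (T m *m w m) <= al by rewrite lerBlDr -lerBlDl.
  apply: le_trans (ler_wpM2l c1' t1) _.
  by rewrite -[leRHS]mul1r ler_wpM2r // gerBl ltW.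
apply: (@le_trans _ _ (\sum_(j < M | j != m) (be + c))).
  apply: ler_sum => j jm; rewrite trT' lerD2r.
  apply: le_trans (Tj _ _ jm).
  rewrite -[leRHS]mul1r ler_wpM2r ?tr_psdM_ge0 // gerBl ltW //.
(* The [M - 1] wrong messages are counted as [M]. *)
rewrite sumr_const -[leLHS]mulr_natl ler_wpM2r ?addr_ge0 ?(ltW c0) // ler_nat.
by rewrite -[leqRHS](card_ord M) max_card.
Qed.

End PrettyGoodMeasurement.

(** * Index computations on bipartite registers *)

Section BipartiteIndices.
Variable C : numClosedFieldType.

Definition unindex m n (p : 'I_(m * n)) : 'I_m * 'I_n :=
  enum_val (cast_ord (esym (mxvec_cast m n)) p).

Lemma mxvec_indexK m n i j : unindex (@mxvec_index m n i j) = (i, j).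
Proof. by rewrite /unindex cast_ordK enum_rankK. Qed.

Lemma mxvec_index_eq m n (i i' : 'I_m) (j j' : 'I_n) :
  (mxvec_index i j == mxvec_index i' j') = (i == i') && (j == j').
Proof. by rewrite (can_eq (@cast_ordK _ _ _)) (can_eq enum_rankK) xpair_eqE. Qed.

Lemma sum_mxvec_index (V : nmodType) m n (F : 'I_(m * n) -> V) :
  \sum_p F p = \sum_i \sum_j F (mxvec_index i j).
Proof.
rewrite pair_big (reindex _ (curry_mxvec_bij m n)).
by apply: eq_bigr => -[].
Qed.

Lemma tensE m1 n1 m2 n2 (A : 'M[C]_(m1, n1)) (B : 'M[C]_(m2, n2)) i1 j1 i2 j2 :
  tens A B (mxvec_index i1 i2) (mxvec_index j1 j2) = A i1 j1 * B i2 j2.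
Proof.
pose D i j k l : C := ((i1 == i) && (i2 == k) && ((j1 == j) && (j2 == l)))%:R.
transitivity (\sum_i \sum_j \sum_k \sum_l A i j * B k l * D i j k l).
  do 4 (rewrite summxE; apply: eq_bigr => ? _).
  by rewrite !mxE !mxvec_index_eq.
rewrite (bigD1 i1) // (bigD1 j1) // (bigD1 i2) // (bigD1 j2) //= /D !eqxx mulr1.
rewrite !big1 ?addr0 // => [k ki|k ki|k ki|k ki]; rewrite ?big1 // => *; rewrite ?big1 // => *;
  rewrite ?big1 // => *; by rewrite [_ == k]eq_sym (negbTE ki) ?andbF mulr0.
Qed.

Lemma tens_idE a b (Phi : 'M[C]_a -> 'M[C]_b) k (X : 'M[C]_(a * k)) i j s t :
  tens_id Phi k X (mxvec_index i s) (mxvec_index j t) = Phi (blk X s t) i j.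
Proof.
rewrite summxE (bigD1 s) //= [X in _ + X]big1 ?addr0 => [|r rs]; last first.
  by rewrite summxE big1 // => ? _; rewrite tensE mxE [s == r]eq_sym (negbTE rs) mulr0.
rewrite summxE (bigD1 t) //= [X in _ + X]big1 ?addr0 => [|r rt]; last first.
  by rewrite tensE mxE [t == r]eq_sym (negbTE rt) andbF mulr0.
by rewrite tensE mxE !eqxx mulr1.
Qed.

Lemma blk_tens_id a b (Phi : 'M[C]_a -> 'M[C]_b) k (X : 'M[C]_(a * k)) s t :
  blk (tens_id Phi k X) s t = Phi (blk X s t).
Proof. by apply/matrixP=> i j; rewrite mxE tens_idE. Qed.

(** Splits the composite map of [EA_code], so that the CPTP properties of the encoder and of the
    channel apply in turn. *)
Lemma tens_id_comp a b c (Phi : 'M[C]_a -> 'M[C]_b) (Psi : 'M[C]_b -> 'M[C]_c)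
    k (X : 'M[C]_(a * k)) :
  tens_id (fun Y => Psi (Phi Y)) k X = tens_id Psi k (tens_id Phi k X).
Proof. by apply: eq_bigr => s _; apply: eq_bigr => t _; rewrite blk_tens_id. Qed.

Lemma ptr2E a k (X : 'M[C]_(a * k)) : ptr2 X = \sum_s blk X s s.
Proof.
by apply/matrixP=> i j; rewrite mxE summxE; apply: eq_bigr => s _; rewrite mxE.
Qed.

Lemma tr_ptr1 m n (X : 'M[C]_(m * n)) : \tr (ptr1 X) = \tr X.
Proof.
rewrite /mxtrace sum_mxvec_index exchange_big /=.
by apply: eq_bigr => i _; rewrite mxE.
Qed.

Lemma tr_ptr2 m n (X : 'M[C]_(m * n)) : \tr (ptr2 X) = \tr X.
Proof.
by rewrite /mxtrace sum_mxvec_index; apply: eq_bigr => i _; rewrite mxE.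
Qed.

Lemma linear_map0 a b (Phi : 'M[C]_a -> 'M[C]_b) : linear_map Phi -> Phi 0 = 0.
Proof.
move=> lin; have := lin (-1) 0 0.
by rewrite scaler0 addr0 scaleN1r addNr.
Qed.

Lemma linear_mapZ a b (Phi : 'M[C]_a -> 'M[C]_b) c X :
  linear_map Phi -> Phi (c *: X) = c *: Phi X.
Proof. by move=> lin; have := lin c X 0; rewrite (linear_map0 lin) !addr0. Qed.

Lemma linear_map_sum a b (Phi : 'M[C]_a -> 'M[C]_b) (I : finType) (F : I -> 'M[C]_a) :
  linear_map Phi -> Phi (\sum_i F i) = \sum_i Phi (F i).
Proof.
move=> lin; apply: (big_morph Phi _ (linear_map0 lin)) => X Y.
by have := lin 1 X Y; rewrite !scale1r.
Qed.

Lemma ptr2_tens_id a b (Phi : 'M[C]_a -> 'M[C]_b) k (X : 'M[C]_(a * k)) :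
  linear_map Phi -> ptr2 (tens_id Phi k X) = Phi (ptr2 X).
Proof.
move=> lin; rewrite !ptr2E linear_map_sum //.
by apply: eq_bigr => s _; rewrite blk_tens_id.
Qed.

Lemma tr_tens_id a b (Phi : 'M[C]_a -> 'M[C]_b) k (X : 'M[C]_(a * k)) :
  is_CPTP Phi -> \tr (tens_id Phi k X) = \tr X.
Proof. by case=> lin _ tp; rewrite -tr_ptr2 ptr2_tens_id // tp tr_ptr2. Qed.

End BipartiteIndices.

(* [h z] (for [P z]) lists the basis vectors of the [z]-th copy of a [d]-dimensional
   factor of the [D]-dimensional space: [block_trace] traces out the label [z]
   and [block_lift] tensors an operator with the identity on the label. *)
Section BlockTrace.
Variable C : numClosedFieldType.
Variables (d D : nat) (Z : finType) (P : pred Z) (h : Z -> 'I_d -> 'I_D).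

Definition block_trace (X : 'M[C]_D) : 'M[C]_d := \sum_(z | P z) mxsub (h z) (h z) X.

Definition block_inj z : 'M[C]_(d, D) := rowsub (h z) 1%:M.

Definition block_lift (A : 'M[C]_d) : 'M[C]_D :=
  \sum_(z | P z) dag (block_inj z) *m A *m block_inj z.

(** Puts [block_trace] in Kraus form with operators [block_inj z], from which its positivity and its
    adjoint [block_lift] follow. *)
Lemma mxsub_block_inj z (X : 'M[C]_D) :
  mxsub (h z) (h z) X = block_inj z *m X *m dag (block_inj z).
Proof.
have -> : dag (block_inj z) = colsub (h z) 1%:M.
  by apply/matrixP=> i j; rewrite !mxE conjC_nat eq_sym.
by rewrite mul_rowsub_mx mul1mx mulmx_colsub mulmx1; apply/matrixP=> i j; rewrite !mxE.
Qed.

Lemma psd_block_trace X : psd X -> psd (block_trace X).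
Proof.
move=> pX; apply: psd_sum => z _; rewrite mxsub_block_inj.
by rewrite -{1}(dagK (block_inj z)); apply: psd_conj.
Qed.

Lemma psd_block_lift A : psd A -> psd (block_lift A).
Proof. by move=> pA; apply: psd_sum => z _; apply: psd_conj. Qed.

Lemma block_lift_adjoint A X : \tr (block_lift A *m X) = \tr (A *m block_trace X).
Proof.
rewrite mulmx_suml mulmx_sumr !linear_sum; apply: eq_bigr => z _ /=.
by rewrite mxsub_block_inj mulmxA -!mulmxA mxtrace_mulC !mulmxA.
Qed.

Lemma linear_block_trace : linear_map block_trace.
Proof.
move=> c X Y; rewrite scaler_sumr -big_split; apply: eq_bigr => z _.
by apply/matrixP=> i j; rewrite !mxE.
Qed.

(** The indices [h z i] with [P z] enumerate the basis exactly once; the form with sums spares an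
    explicit bijection. *)
Hypothesis hP : forall F : 'I_D -> C, \sum_(z | P z) \sum_i F (h z i) = \sum_q F q.

Lemma tr_block_trace X : \tr (block_trace X) = \tr X.
Proof.
rewrite linear_sum /= -[RHS](hP (fun q => X q q)); apply: eq_bigr => z _.
by apply: eq_bigr => i _; rewrite mxE.
Qed.

Lemma block_lift1 : block_lift 1%:M = 1%:M.
Proof.
apply/matrixP=> p q; rewrite summxE.
transitivity (\sum_r ((r == p)%:R * (r == q)%:R : C)).
  rewrite -hP; apply: eq_bigr => z _; rewrite mulmx1 mxE.
  by apply: eq_bigr => i _; rewrite !mxE conjC_nat.
rewrite (bigD1 p) //= big1 ?addr0 => [|r /negbTE->]; last by rewrite mul0r.
by rewrite eqxx mul1r mxE.
Qed.

Lemma block_liftB A B : block_lift (A - B) = block_lift A - block_lift B.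
Proof.
by rewrite -sumrB; apply: eq_bigr => z _; rewrite mulmxBr mulmxBl.
Qed.

End BlockTrace.

(** * The [M] shared copies and Bob's reduced states *)

Section PositionBasedCode.
Variable C : numClosedFieldType.
Variables (a M : nat) (i0 : 'I_a).

(** Words index the basis of the [M]-fold tensor power. Taking its dimension as a cardinal lets
    [enum_rank] and [enum_val] do the indexing. *)
Local Notation word := {ffun 'I_M -> 'I_a}.
Local Notation dimW := #|{: word}|.
Local Notation "q @_ k" := ((enum_val q : word) k) (at level 10).

Definition upd (z : word) m i : word := [ffun k => if k == m then i else z k].

(* The words with letter [i0] at position [m] label the contents of the other positions. *)
Definition rest m : pred word := fun z => z m == i0.

Lemma sum_upd (V : nmodType) m (G : word -> V) :
  \sum_(z | rest m z) \sum_i G (upd z m i) = \sum_x G x.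
Proof.
rewrite pair_big_dep /= (reindex (fun x : word => (upd x m i0, x m))) /=.
  apply: eq_big => [x|x _]; first by rewrite /rest ffunE !eqxx.
  by congr G; apply/ffunP=> k; rewrite !ffunE; case: eqP => [->|].
exists (fun p => upd p.1 m p.2) => [x _|[z i]] /=.
  by apply/ffunP=> k; rewrite !ffunE; case: eqP => [->|].
rewrite inE andbT => /eqP zm; congr (_, _); last by rewrite ffunE eqxx.
by apply/ffunP=> k; rewrite !ffunE; case: eqP => [->|].
Qed.

(** Distributivity of product over sum, with the constraint [z m == i0] absorbed as a 0-1 factor at
    position [m]. *)
Lemma sum_rest_prod m (g : 'I_M -> 'I_a -> C) :
  \sum_(z | rest m z) \prod_(k | k != m) g k (z k) = \prod_(k | k != m) \sum_c g k c.
Proof.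
pose G k c := if k == m then (c == i0)%:R else g k c.
have GE k : k != m -> G k = g k by rewrite /G => /negbTE->.
transitivity (\sum_(z : word) \prod_k G k (z k)).
  rewrite big_mkcond; apply: eq_bigr => z _; rewrite [in RHS](bigD1 m) //= {1}/G eqxx /rest.
  case: eqP => _; last by rewrite mul0r.
  by rewrite mul1r; apply: eq_bigr => k /GE->.
rewrite -(bigA_distr_bigA G) [LHS](bigD1 m) //= {1}/G eqxx.
rewrite (bigD1 i0) //= eqxx big1 ?addr0 ?mul1r => [|c /negbTE->] //.
by apply: eq_bigr => k /GE->.
Qed.

Lemma sum_enum_rank (V : nmodType) (G : 'I_dimW -> V) :
  \sum_q G q = \sum_(x : word) G (enum_rank x).
Proof. by rewrite (reindex _ (onW_bij _ (@enum_rank_bij word))). Qed.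

(** The variants [site_l] and [site_r] carry a spectator: a reference on the right for the encoder,
    the channel output on the left for the decoder. *)
Definition site m (z : word) (i : 'I_a) : 'I_dimW := enum_rank (upd z m i).

Definition site_l k m z (p : 'I_(a * k)) : 'I_(dimW * k) :=
  mxvec_index (site m z (unindex p).1) (unindex p).2.

Definition site_r b m z (p : 'I_(b * a)) : 'I_(b * dimW) :=
  mxvec_index (unindex p).1 (site m z (unindex p).2).

Lemma sum_site m (G : 'I_dimW -> C) :
  \sum_(z | rest m z) \sum_i G (site m z i) = \sum_q G q.
Proof. by rewrite sum_enum_rank -(sum_upd m). Qed.

Lemma sum_site_r b m (G : 'I_(b * dimW) -> C) :
  \sum_(z | rest m z) \sum_p G (site_r m z p) = \sum_q G q.
Proof.
rewrite sum_mxvec_index.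
under [RHS]eq_bigr => s _ do rewrite -(sum_site m).
rewrite [RHS]exchange_big /=; apply: eq_bigr => z _; rewrite sum_mxvec_index.
by apply: eq_bigr => s _; apply: eq_bigr => i _; rewrite /site_r mxvec_indexK.
Qed.

(** Alice's encoding of [m]: all her halves but the [m]-th are discarded. *)
Definition pick_site m : 'M[C]_dimW -> 'M[C]_a := block_trace (rest m) (site m).

(** With a reference attached, the encoder is again a block trace, hence completely positive. *)
Lemma tens_id_pick_site m k (X : 'M[C]_(dimW * k)) :
  tens_id (pick_site m) k X = block_trace (rest m) (@site_l k m) X.
Proof.
apply/matrixP=> p q; case/mxvec_indexP: p => i s; case/mxvec_indexP: q => j t.
rewrite tens_idE !summxE; apply: eq_bigr => z _.
by rewrite !mxE /site_l !mxvec_indexK.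
Qed.

Lemma pick_site_CPTP m : is_CPTP (pick_site m).
Proof.
split; first exact: linear_block_trace.
- by move=> k X pX; rewrite tens_id_pick_site; apply: psd_block_trace.
- by move=> X; apply: tr_block_trace; apply: sum_site.
Qed.

(** The [M]-th tensor power of [X], regrouped so that all of Alice's halves precede all of Bob's. *)
Definition copies (X : 'M[C]_(a * a)) : 'M[C]_(dimW * dimW) :=
  \matrix_(p, q) \prod_(k < M)
     X (mxvec_index ((unindex p).1 @_ k) ((unindex p).2 @_ k))
       (mxvec_index ((unindex q).1 @_ k) ((unindex q).2 @_ k)).

Lemma copies_pure psi : is_pure_state psi -> is_pure_state (copies psi).
Proof.
case=> v [v1 ->].
pose w : 'cV[C]_(dimW * dimW) := \col_p \prod_(k < M)
  v (mxvec_index ((unindex p).1 @_ k) ((unindex p).2 @_ k)) 0.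
exists w; split; last first.
  apply/matrixP=> p q; rewrite !mxE big_ord1 !mxE rmorph_prod -big_split.
  by apply: eq_bigr => k _; rewrite !mxE big_ord1 !mxE.
apply/matrixP=> s t; rewrite !ord1.
have := congr1 (fun X : 'M[C]_1 => X 0 0) v1; rewrite !mxE => v1'.
rewrite sum_mxvec_index sum_enum_rank.
pose g i j := (v (mxvec_index i j) 0)^* * v (mxvec_index i j) 0.
transitivity (\sum_(x : word) \sum_(y : word) \prod_k g (x k) (y k)).
  apply: eq_bigr => x _; rewrite sum_enum_rank; apply: eq_bigr => y _.
  by rewrite !mxE !mxvec_indexK /= !enum_rankK rmorph_prod -big_split.
under eq_bigr => x _ do rewrite -(bigA_distr_bigA (fun k => g (x k))).
rewrite -(bigA_distr_bigA (fun _ i => \sum_j g i j)) big1 // => k _.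
rewrite eqxx in v1'; rewrite -[RHS]v1' sum_mxvec_index.
by apply: eq_bigr => i _; apply: eq_bigr => j _; rewrite !mxE.
Qed.

(** Discarding Alice's half of a copy [k != m] leaves the marginal [ptr1 psi] on Bob's side. *)
Lemma pick_site_copies m psi (y y' : word) :
  pick_site m (blk (copies psi) (enum_rank y) (enum_rank y'))
  = (\prod_(k | k != m) ptr1 psi (y k) (y' k)) *: blk psi (y m) (y' m).
Proof.
apply/matrixP=> i j; rewrite summxE !mxE.
transitivity (\sum_(z | rest m z) (\prod_(k | k != m)
    psi (mxvec_index (z k) (y k)) (mxvec_index (z k) (y' k))) *
    psi (mxvec_index i (y m)) (mxvec_index j (y' m))).
  apply: eq_bigr => z _; rewrite !mxE !mxvec_indexK /= !enum_rankK (bigD1 m) //=.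
  rewrite !ffunE eqxx mulrC; congr (_ * _); apply: eq_bigr => k /negbTE km.
  by rewrite !ffunE km.
rewrite -mulr_suml; congr (_ * _).
rewrite (sum_rest_prod m (fun k c => psi (mxvec_index c (y k)) (mxvec_index c (y' k)))).
by apply: eq_bigr => k _; rewrite mxE.
Qed.

Variables (b : nat) (N : 'M[C]_a -> 'M[C]_b).

Definition output m psi : 'M[C]_(b * dimW) :=
  tens_id (fun X => N (pick_site m X)) dimW (copies psi).

Lemma outputE m psi p p' (y y' : word) : linear_map N ->
  output m psi (mxvec_index p (enum_rank y)) (mxvec_index p' (enum_rank y'))
  = (\prod_(k | k != m) ptr1 psi (y k) (y' k))
    * tens_id N a psi (mxvec_index p (y m)) (mxvec_index p' (y' m)).
Proof.
by move=> lin; rewrite !tens_idE pick_site_copies linear_mapZ // mxE.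
Qed.

Definition site_trace m : 'M[C]_(b * dimW) -> 'M[C]_(b * a) :=
  block_trace (rest m) (@site_r b m).

Lemma site_traceE m X p p' i i' :
  site_trace m X (mxvec_index p i) (mxvec_index p' i')
  = \sum_(z | rest m z) X (mxvec_index p (enum_rank (upd z m i)))
                          (mxvec_index p' (enum_rank (upd z m i'))).
Proof.
by rewrite summxE; apply: eq_bigr => z _; rewrite mxE /site_r !mxvec_indexK.
Qed.

Lemma site_trace_same m psi : linear_map N -> \tr psi = 1 ->
  site_trace m (output m psi) = tens_id N a psi.
Proof.
move=> lin tr1; apply/matrixP=> p q.
case/mxvec_indexP: p => p i; case/mxvec_indexP: q => p' i'.
rewrite site_traceE.
transitivity (\sum_(z | rest m z) (\prod_(k | k != m) ptr1 psi (z k) (z k))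
   * tens_id N a psi (mxvec_index p i) (mxvec_index p' i')).
  apply: eq_bigr => z _; rewrite outputE // !ffunE eqxx; congr (_ * _).
  by apply: eq_bigr => k /negbTE km; rewrite !ffunE km.
rewrite -mulr_suml (sum_rest_prod m (fun _ c => ptr1 psi c c)) big1 ?mul1r // => _ _.
by rewrite -[RHS]tr1 -tr_ptr1.
Qed.

Lemma site_trace_other m j psi : linear_map N -> \tr psi = 1 -> j != m ->
  site_trace j (output m psi) = tens (N (ptr2 psi)) (ptr1 psi).
Proof.
move=> lin tr1 jm; apply/matrixP=> p q.
case/mxvec_indexP: p => p i; case/mxvec_indexP: q => p' i'.
rewrite site_traceE tensE.
pose rho := tens_id N a psi.
(* Copy [m] is traced out next to the channel output, which turns [rho] into [N (ptr2 psi)]; every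
   remaining copy contributes the trace 1. *)
pose g k c := if k == m then rho (mxvec_index p c) (mxvec_index p' c) else ptr1 psi c c.
transitivity (\sum_(z | rest j z) ptr1 psi i i' * \prod_(k | k != j) g k (z k)).
  apply: eq_bigr => z _; rewrite outputE // (bigD1 j) //= !ffunE eqxx -mulrA.
  congr (_ * _); rewrite [RHS](bigD1 m) /=; last by rewrite eq_sym.
  rewrite /g eqxx mulrC.
  rewrite [m == j]eq_sym (negbTE jm); congr (_ * _).
  apply: eq_big => [k|k /andP[km kj]]; first exact: andbC.
  by rewrite !ffunE (negbTE kj) (negbTE km).
rewrite -mulr_sumr (sum_rest_prod j g) mulrC; congr (_ * _).
rewrite (bigD1 m) /=; last by rewrite eq_sym.
rewrite [X in _ * X]big1 ?mulr1 => [|k /andP[_ /negbTE km]]; last first.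
  by rewrite /g km -[RHS]tr1 -tr_ptr1.
by rewrite /g eqxx -ptr2_tens_id // mxE.
Qed.

Definition site_test m : 'M[C]_(b * a) -> 'M[C]_(b * dimW) :=
  block_lift (rest m) (@site_r b m).

End PositionBasedCode.

(** * Choice of the test and assembly of the code *)

Lemma psd_pure (C : numClosedFieldType) n (psi : 'M[C]_n) : is_pure_state psi -> psd psi.
Proof. by case=> v [_ ->]; have := psd_gram (dag v); rewrite dagK. Qed.

Lemma tr_pure (C : numClosedFieldType) n (psi : 'M[C]_n) : is_pure_state psi -> \tr psi = 1.
Proof. by case=> v [v1 ->]; rewrite mxtrace_mulC v1 mxtrace1. Qed.

Lemma DH_test (C : numClosedFieldType) n (rho sigma : 'M[C]_n) (eps t s : C) :
  exp2_DH_ge rho sigma eps t -> 0 < s -> s^-1 < t ->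
  exists Pi : 'M[C]_n, [/\ psd Pi, psd (1%:M - Pi),
    1 - eps ^+ 2 <= \tr (Pi *m rho) & \tr (Pi *m sigma) <= s].
Proof.
move=> DH s0 st; have [Pi [pPi pPi1 Prho Psigma]] := DH _ st.
exists Pi; split=> //; apply: ltW.
by rewrite mulrC ltr_pdivrMr // mul1r in Psigma.
Qed.

Theorem theorem1 (C : numClosedFieldType) (a b : nat)
  (N : 'M[C]_a -> 'M[C]_b) (eps delta : C) (M : nat) (psi : 'M[C]_(a * a)) :
  is_CPTP N ->
  0 < eps < 1 -> 0 < delta < 1 ->
  (0 < M)%N ->
  is_pure_state psi ->
  exp2_DH_ge (tens_id N a psi) (tens (N (ptr2 psi)) (ptr1 psi)) eps
             (M%:R / delta ^+ 2) ->
  EA_code N M (2 * eps + 2 * delta).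
Proof.
move=> cptpN /andP[e0 e1] /andP[d0 d1] M0 pure DH.
have [lin cpN tpN] := cptpN.
have tr1 := tr_pure pure.
(* The reference letter exists because a state of trace 1 forces [a > 0]. *)
have i0 : 'I_a.
  case: (a) psi tr1 {pure DH cptpN lin cpN tpN N} => [|k] psi tr1; last exact: ord0.
  by move: tr1; rewrite /mxtrace big_ord0 => /esym/eqP; rewrite oner_eq0.
have MC : 0 < M%:R :> C by rewrite ltr0n.
(* The slack [2 eps delta] absorbs the fact that [D_H] is only a supremum. *)
pose s := (delta ^+ 2 + 2 * eps * delta) / M%:R.
have num0 : 0 < delta ^+ 2 + 2 * eps * delta by rewrite addr_gt0 ?exprn_gt0 ?mulr_gt0.
have s0 : 0 < s by rewrite divr_gt0.
have st : s^-1 < M%:R / delta ^+ 2.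
  rewrite invf_div ltr_pM2l // ltf_pV2 ?posrE ?exprn_gt0 //.
  by rewrite ltrDl !mulr_gt0.
have [Pi [pPi pPi1 Prho Psigma]] := DH_test DH s0 st.
(* Chosen so that [4 M c = 2 eps^2], while [4 M s = 4 (delta^2 + 2 eps delta)]. *)
pose c := eps ^+ 2 / (2 * M%:R).
have c01 : 0 < c <= 1.
  rewrite divr_gt0 ?exprn_gt0 ?mulr_gt0 //= ler_pdivrMr ?mulr_gt0 // mul1r.
  apply: (@le_trans _ _ 1); first by rewrite exprn_ile1 ?ltW.
  by rewrite -natrM ler1n muln_gt0.
have cptpE (m : 'I_M) := pick_site_CPTP C i0 m.
pose w (m : 'I_M) := output i0 N m psi.
have adj m j : \tr (site_test i0 j Pi *m w m) = \tr (Pi *m site_trace i0 j (w m)).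
  exact: block_lift_adjoint.
have [||m|m|m|m|m|m j jm|Lam [pLam err]] :=
  @hypothesis_decoder C _ M (fun m => site_test i0 m Pi) w (eps ^+ 2) s c M0 c01.
- by rewrite exprn_ge0 ?ltW.
- exact: ltW.
- exact: psd_block_lift.
(* The complement of the lifted test is the lift of [1 - Pi]. *)
- rewrite -(block_lift1 (@sum_site_r C _ _ i0 b m)) -block_liftB; exact: psd_block_lift.
- rewrite /w /output tens_id_comp; apply: cpN.
  by have [_ cpE _] := cptpE m; apply: cpE; apply: psd_pure; apply: copies_pure.
- by rewrite /w /output tens_id_comp !tr_tens_id // tr_pure //; apply: copies_pure.
- by rewrite adj site_trace_same.
- by rewrite adj site_trace_other.
exists #|{: {ffun 'I_M -> 'I_a}}|, #|{: {ffun 'I_M -> 'I_a}}|, (copies M psi).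
exists (pick_site i0), Lam; split=> // [|m]; first exact: copies_pure.
apply: le_trans (err m) _.
suff -> : 2 * eps ^+ 2 + 4 * (M%:R * (s + c)) = (2 * eps + 2 * delta) ^+ 2 by [].
by rewrite /s /c; field; exact: lt0r_neq0.
Qed.
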